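(* Let $X$ and $Y$ be indistinguishable finite metric spaces. Then $\#X=\#Y$, $\operatorname{diam}X=\operatorname{diam}Y$, and their $\operatorname{mst}$-spectra coincide, i.e. $\sigma(X)=\sigma(Y)$.
   Context: All metric spaces are non-empty; $\#X$ is the cardinality of $X$ and $\operatorname{diam}X=\sup\{|xy|:x,y\in X\}$, where $|xy|$ is the distance between $x$ and $y$. $d_{GH}$ is the Gromov--Hausdorff distance (possibly infinite): the infimum of the $r$ such that $X$ and $Y$ embed isometrically in a common metric space with Hausdorff distance between their images at most $r$. For a cardinal $n\ge1$, $\Delta_n$ is the metric space of cardinality $n$ with all non-zero distances equal to $1$; for $\lambda>0$, $\lambda\Delta_n$ is obtained by multiplying all distances by $\lambda$, and $0\Delta_n:=\Delta_1$ (one point). The spaces $\lambda\Delta_n$ are called simplexes. Metric spaces $X$ and $Y$ are indistinguishable if $d_{GH}(\lambda\Delta_n,X)=d_{GH}(\lambda\Delta_n,Y)$ for every cardinal $n\ge1$ and every real $\lambda\ge0$. For a finite metric space $M$, a minimal spanning tree on $M$ is a tree $G=(M,E)$ with vertex set $M$ whose total edge length (the length of an edge $vw$ being $|vw|$) is minimal among all trees with vertex set $M$. The vector of edge lengths of $G$, written in descending order, does not depend on the choice of the minimal spanning tree $G$; it is denoted by $\sigma(M)$ and called the $\operatorname{mst}$-spectrum of $M$ (it has $\#M-1$ components). *)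

(* Defs.v *)
From HB Require Import structures.
From mathcomp Require Import all_boot all_order all_algebra.
From mathcomp Require Import all_classical all_reals.
From mathcomp Require Import ereal topology.

Set Implicit Arguments.
Unset Strict Implicit.
Unset Printing Implicit Defensive.

Import Order.TTheory GRing.Theory Num.Theory.

Local Open Scope classical_set_scope.
Local Open Scope ring_scope.

#[short(type="finMetricType")]
HB.structure Definition FinMetric (R : numDomainType) :=
  { T of Finite T & Metric R T }.

Section GromovHausdorff.
Context {R : realType}.

Definition isometric (X Z : metricType R) (f : X -> Z) : Prop :=
  forall x y, mdist (f x) (f y) = mdist x y.

(* Meaningful for non-empty A and B only: the supremum over the empty set
   is -oo. *)
Definition hausdorff_dist (Z : metricType R) (A B : set Z) : \bar R :=
  maxe (ereal_sup [set ereal_inf [set (mdist a b)%:E | b in B] | a in A])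
       (ereal_sup [set ereal_inf [set (mdist a b)%:E | a in A] | b in B]).

Definition dGH (X Y : metricType R) : \bar R :=
  ereal_inf [set r%:E | r in [set r : R |
    exists (Z : metricType R) (f : X -> Z) (g : Y -> Z),
      [/\ isometric f, isometric g &
          (hausdorff_dist (range f) (range g) <= r%:E)%E]]].

Definition diam (X : metricType R) : \bar R :=
  ereal_sup [set (mdist p.1 p.2)%:E | p in [set: X * X]].

End GromovHausdorff.

(* A copy of n carrying the metric whose non-zero distances are all 1; a
   cardinal is represented by an arbitrary type of that cardinality. *)
Definition Delta (R : realType) (n : choiceType) : Type := n.

Section Delta.
Context (R : realType) (n : choiceType).

HB.instance Definition _ := Choice.copy (Delta R n) n.

Let dist (x y : Delta R n) : R := (x != y)%:R.

Let distxx x : dist x x = 0.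
Proof. by rewrite /dist eqxx. Qed.

Let dist_positivity x y : dist x y = 0 -> x = y.
Proof. by rewrite /dist; case: eqVneq => //= _ /eqP; rewrite oner_eq0. Qed.

Let dist_sym x y : dist x y = dist y x.
Proof. by rewrite /dist eq_sym. Qed.

Let dist_triangle y x z : dist x z <= dist x y + dist y z.
Proof.
rewrite /dist -natrD ler_nat; case: (eqVneq x y) => [->|_] //=.
by case: (x != z); rewrite ?leq_addr.
Qed.

HB.instance Definition _ := isMetric.Build R (Delta R n)
  distxx dist_positivity dist_sym dist_triangle.

Lemma mdist_Delta (x y : Delta R n) : mdist x y = (x != y)%:R.
Proof. by []. Qed.

End Delta.

Definition scaled (R : realType) (lam : R) (lam_gt0 : 0 < lam)
  (X : metricType R) : Type := X.

Section Scaled.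
Context (R : realType) (lam : R) (lam_gt0 : 0 < lam) (X : metricType R).

HB.instance Definition _ := Choice.copy (scaled lam_gt0 X) X.

Let dist (x y : scaled lam_gt0 X) : R := lam * mdist (x : X) (y : X).

Let distxx x : dist x x = 0.
Proof. by rewrite /dist mdistxx mulr0. Qed.

Let dist_positivity x y : dist x y = 0 -> x = y.
Proof.
move=> /eqP; rewrite mulf_eq0 gt_eqF //= => /eqP.
exact: mdist_positivity.
Qed.

Let dist_sym x y : dist x y = dist y x.
Proof. by rewrite /dist metric_sym. Qed.

Let dist_triangle y x z : dist x z <= dist x y + dist y z.
Proof. by rewrite /dist -mulrDr ler_pM2l // metric_triangle. Qed.

HB.instance Definition _ := isMetric.Build R (scaled lam_gt0 X)
  distxx dist_positivity dist_sym dist_triangle.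

Lemma mdist_scaled (x y : scaled lam_gt0 X) :
  mdist x y = lam * mdist (x : X) (y : X).
Proof. by []. Qed.

End Scaled.

Section Indistinguishable.
Context {R : realType}.

(* The second branch is the convention 0 Delta_n := Delta_1; negative lam
   never occurs. *)
Definition simplex (lam : R) (n : choiceType) : metricType R :=
  if @idP (0 < lam) is ReflectT lam_gt0
  then scaled lam_gt0 (Delta R n) else Delta R unit.

Lemma simplex_gt0 (lam : R) (lam_gt0 : 0 < lam) (n : choiceType) :
  simplex lam n = scaled lam_gt0 (Delta R n).
Proof.
rewrite /simplex; case: {-}_ / idP => // lam_gt0'.
by rewrite (bool_irrelevance lam_gt0' lam_gt0).
Qed.

Lemma simplex0 (n : choiceType) : simplex 0 n = Delta R unit.
Proof. by rewrite /simplex; case: {-}_ / idP => // h; exfalso; move: h; rewrite ltxx. Qed.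

Definition indistinguishable (X Y : metricType R) : Prop :=
  forall n : choiceType, [set: n] !=set0 ->
  forall lam : R, 0 <= lam -> dGH (simplex lam n) X = dGH (simplex lam n) Y.

End Indistinguishable.

Section Graph.
Context (T : finType).
Implicit Type E : {set {set T}}.

Definition simple_graph E : bool := [forall e in E, #|e| == 2%N].

Definition adj E : rel T := [rel x y | [set x; y]%SET \in E].

Definition connected_graph E : bool := [forall x, forall y, connect (adj E) x y].

(* Every duplicate-free closed walk is degenerate: one of length 2 only
   traverses a single edge back and forth. *)
Definition acyclic E : Prop := forall c : seq T, ucycle (adj E) c -> (size c <= 2)%N.

Definition is_tree E : Prop :=
  [/\ simple_graph E, connected_graph E & acyclic E].

End Graph.

Section MinimalSpanningTree.
Context {R : realType} (M : finMetricType R).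
Implicit Types (e : {set M}) (E : {set {set M}}).

Definition edge_length e : R :=
  if [pick p : M * M | e == [set p.1; p.2]%SET] is Some p
  then mdist p.1 p.2 else 0.

Definition total_length E : R := \sum_(e in E) edge_length e.

Definition is_mst E : Prop :=
  is_tree E /\ forall E', is_tree E' -> total_length E <= total_length E'.

Definition edge_lengths E : seq R :=
  sort >=%R [seq edge_length e | e <- enum E].

(* All minimal spanning trees have the same vector of edge lengths, so any one
   of them will do; there is one when M is non-empty (mst_exists). *)
Definition mst_spectrum : seq R :=
  edge_lengths (odflt finset.set0 [pick E | `[< is_mst E >]]).

Lemma edge_length2 (x y : M) : edge_length [set x; y]%SET = mdist x y.
Proof.
rewrite /edge_length; case: pickP => [[u v] /= /eqP E | /(_ (x, y))]; last first.
  by rewrite /= eqxx.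
have : u \in [set x; y]%SET by rewrite E set21.
have : v \in [set x; y]%SET by rewrite E set22.
have : x \in [set u; v]%SET by rewrite -E set21.
have : y \in [set u; v]%SET by rewrite -E set22.
rewrite !finset.inE.
by do 4 ![case/orP => /eqP ?]; subst => //; rewrite metric_sym.
Qed.

Lemma mst_exists : (0 < #|M|)%N -> exists E, is_mst E.
Proof.
move=> /card_gt0P[x0 _].
pose star : {set {set M}} := [set [set x0; x] | x in [set~ x0]]%SET.
have adjE x y : adj star x y = (x != y) && ((x == x0) || (y == x0)).
  apply/imsetP/idP => [[z]|/andP[xy /orP[]/eqP e]].
  - rewrite !finset.inE => zx0 E.
    have : x0 \in [set x; y]%SET by rewrite E set21.
    have : z \in [set x; y]%SET by rewrite E set22.
    rewrite !finset.inE.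
    by do 2 ![case/orP => /eqP ?]; subst; rewrite ?eqxx ?orbT ?andbT //= in zx0 *;
       rewrite // eq_sym.
  - by subst; exists y; rewrite // !finset.inE eq_sym.
  - by subst; exists x; rewrite ?finset.inE // finset.setUC.
have star_tree : is_tree star.
  split.
  - apply/forall_inP => e /imsetP[x]; rewrite !finset.inE => xx0 ->.
    by rewrite cards2 [x0 == x]eq_sym xx0.
  - have cx x : connect (adj star) x0 x.
      have [->|xx0] := eqVneq x x0; first exact: connect0.
      by apply: connect1; rewrite adjE eqxx eq_sym xx0.
    have cy x : connect (adj star) x x0.
      have [->|xx0] := eqVneq x x0; first exact: connect0.
      by apply: connect1; rewrite adjE eqxx xx0 orbT.
    by apply/forallP => x; apply/forallP => y; apply: connect_trans (cx y).
  - case=> [|x [|y [|z s]]] //= /andP[/=].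
    rewrite !adjE => /and3P[/andP[xy xy0] /andP[yz yz0] p].
    rewrite !inE !negb_or => /and3P[/and3P[_ xz xs] /andP[_ ys] _].
    have [xE|xN] := eqVneq x x0.
      by move: yz0; rewrite -xE ![_ == x]eq_sym (negbTE xy) (negbTE xz).
    move: xy0; rewrite (negbTE xN) /= => /eqP yE.
    case: s p xs ys => [|w s] /=; rewrite adjE => /andP[].
      by rewrite (negbTE xN) -yE [z == y]eq_sym (negbTE yz) andbF.
    rewrite -yE ![_ == y]eq_sym (negbTE yz) /= => /andP[_ yw] _ _.
    by rewrite inE yw.
have [E /asboolP Etree Emin] := @arg_minP _ _ _ star
  (fun E => `[< is_tree E >]) total_length (introT (asboolP _) star_tree).
by exists E; split=> // E' /asboolP/Emin.
Qed.

End MinimalSpanningTree.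

(* Main.v *)
Require Import Defs.
From HB Require Import structures.
From mathcomp Require Import all_boot all_order all_algebra.
From mathcomp Require Import all_classical all_reals.
From mathcomp Require Import ereal topology.
From mathcomp Require Import lra.

Set Implicit Arguments.
Unset Strict Implicit.
Unset Printing Implicit Defensive.

Import Order.TTheory GRing.Theory Num.Theory.

Local Open Scope ring_scope.

(* Let c_X(t) be the number of connected components of the graph joining the
   points of X at distance at most t; it is the largest number of classes of a
   partition of X whose distinct classes are more than t apart. Once lam is
   large compared with diam X, such a partition into n classes exists if and
   only if d_GH(lam Delta_n, X) < (lam - t) / 2, so indistinguishable spaces
   have the same function c. On the other hand a minimal spanning tree has
   exactly c_X(t) - 1 edges longer than t: the edges of length at most t already
   connect any two points at distance at most t. The spectrum is determined by
   these counts. The diameter is read off n = 1. *)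

(** * Component counts, forests and trees on a finite vertex set *)

Lemma leq_card_imset_ker (T A B : finType) (f : T -> A) (g : T -> B) :
  (forall u v, f u = f v -> g u = g v) ->
  (#|[set g u | u in T]%SET| <= #|[set f u | u in T]%SET|)%N.
Proof.
move=> fg; case: (pickP T) => [x0 _|T0]; last first.
  suff -> : [set g u | u in T]%SET = finset.set0 by rewrite cards0.
  by apply/setP => b; rewrite finset.inE; apply/imsetP => -[u]; have := T0 u.
pose h a := g (odflt x0 [pick u | f u == a]).
suff -> : [set g u | u in T]%SET = [set h a | a in [set f u | u in T]]%SET.
  exact: leq_imset_card.
have hf u : h (f u) = g u.
  rewrite /h; case: pickP => [v /eqP/fg //|/(_ u)]; by rewrite eqxx.
by rewrite -imset_comp; apply: eq_imset => u /=; rewrite hf.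
Qed.

Section Components.
Context (T : finType).
Implicit Types (E F G : {set {set T}}) (x y u v : T).

Definition component F u : {set T} := [set v | connect (adj F) u v]%SET.

Definition ncomp F : nat := #|[set component F u | u in T]%SET|.

Lemma connect_adj_sym F : connect_sym (adj F).
Proof. by apply: sym_connect_sym => u v; rewrite /adj /= finset.setUC. Qed.

Lemma componentE F u v :
  (component F u == component F v) = connect (adj F) u v.
Proof.
apply/eqP/idP => [/setP/(_ v)|uv].
  by rewrite !finset.inE connect0.
apply/setP => w; rewrite !finset.inE.
exact: (same_connect (@connect_adj_sym F)).
Qed.

(** A labelling constant along edges is constant on components, hence factors through
    [component F]. *)
Lemma leq_card_ncomp (A : finType) (f : T -> A) F :
  (forall u v, adj F u v -> f u = f v) ->
  (#|[set f u | u in T]%SET| <= ncomp F)%N.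
Proof.
move=> fF; apply: leq_card_imset_ker => u v /eqP; rewrite componentE.
case/connectP => p; elim: p u => [|w p IH] u /=; first by move=> _ ->.
by case/andP => /fF -> /IH.
Qed.

Lemma connect_adjS E F u v :
  F \subset E -> connect (adj F) u v -> connect (adj E) u v.
Proof.
by move=> /fintype.subsetP FE; apply: connect_sub => x y /FE xy; apply: connect1.
Qed.

Lemma adjU1 F x y u v : adj ([set x; y] |: F)%SET u v ->
  [\/ u = x /\ v = y, u = y /\ v = x | adj F u v].
Proof.
rewrite /adj /= finset.in_setU1 => /orP[/eqP uv|]; last by constructor 3.
have : u \in [set x; y]%SET by rewrite -uv set21.
have : v \in [set x; y]%SET by rewrite -uv set22.
have : x \in [set u; v]%SET by rewrite uv set21.
have : y \in [set u; v]%SET by rewrite uv set22.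
rewrite !finset.inE.
by do 4 ![case/orP => /eqP ?]; subst;
  try (by constructor 1); try (by constructor 2).
Qed.

Lemma ncompU1_connect F x y : connect (adj F) x y ->
  ncomp ([set x; y] |: F)%SET = ncomp F.
Proof.
move=> xy; apply/eqP; rewrite eqn_leq; apply/andP; split.
  apply: leq_card_imset_ker => u v /eqP; rewrite componentE => uv.
  by apply/eqP; rewrite componentE; apply: connect_adjS uv; apply: finset.subsetUr.
apply: leq_card_ncomp => u v /adjU1[[-> ->]|[-> ->]|uv]; apply/eqP;
  rewrite componentE //; first by rewrite connect_adj_sym.
exact: connect1.
Qed.

Lemma ncompU1 F x y : ~~ connect (adj F) x y ->
  ncomp F = (ncomp ([set x; y] |: F)%SET).+1.
Proof.
(* [f] gives the points of the component of [y] the label of the component of [x]. Its fibres are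
   the components of the enlarged graph, and its values are all components of [F] except that of
   [y]. *)
move=> xy; pose f u := if connect (adj F) y u then component F x
                       else component F u.
have -> : ncomp ([set x; y] |: F)%SET = #|[set f u | u in T]%SET|.
  apply/eqP; rewrite eqn_leq; apply/andP; split; last first.
    apply: leq_card_ncomp => u v /adjU1[[-> ->]|[-> ->]|uv]; rewrite /f.
    - by rewrite connect0; case: ifP.
    - by rewrite connect0; case: ifP.
    - have cuv := connect1 uv.
      rewrite (same_connect_r (@connect_adj_sym F) cuv).
      by case: ifP => // _; apply/eqP; rewrite componentE.
  have sub u v : connect (adj F) u v -> connect (adj ([set x; y] |: F)%SET) u v.
    by apply: connect_adjS; apply: finset.subsetUr.
  have xy' : connect (adj ([set x; y] |: F)%SET) x y.
    by apply: connect1; rewrite /adj /= setU11.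
  have fE u : exists2 a, f u = component F a & connect (adj ([set x; y] |: F)%SET) u a.
    rewrite /f; case: ifP => yu; last by exists u; rewrite ?connect0.
    exists x => //; rewrite connect_adj_sym; apply: connect_trans xy' (sub _ _ yu).
  apply: leq_card_imset_ker => u v; have [a -> ua] := fE u; have [b -> vb] := fE v.
  move/eqP; rewrite componentE => /sub ab; apply/eqP; rewrite componentE.
  by rewrite (connect_trans ua) // (connect_trans ab) // connect_adj_sym.
have -> : [set f u | u in T]%SET =
          ([set component F u | u in T] :\ component F y)%SET.
  apply/setP => C; rewrite finset.in_setD1; apply/imsetP/andP.
    case=> u _ ->; rewrite /f; case: ifPn => [_|yu].
      by rewrite componentE xy imset_f.
    by rewrite componentE connect_adj_sym yu imset_f.
  case=> Cy /imsetP[u _ CE]; exists u => //.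
  by rewrite /f ifN // -componentE eq_sym -CE.
by rewrite /ncomp (cardsD1 (component F y) [set component F u | u in T]%SET) imset_f.
Qed.

Lemma ncomp0 : ncomp finset.set0 = #|T|.
Proof.
rewrite /ncomp card_imset // => u v /eqP; rewrite componentE.
by case/connectP => -[|w p] /=; rewrite /adj /= ?finset.in_set0.
Qed.

Lemma ncomp_connected F : (0 < #|T|)%N -> connected_graph F = (ncomp F == 1%N).
Proof.
case/card_gt0P => x0 _; apply/idP/cards1P => [cF|[C CE]].
  exists (component F x0); apply/setP => C; rewrite finset.inE.
  apply/imsetP/eqP => [[u _ ->]|->]; last by exists x0.
  by apply/eqP; rewrite componentE; move/forallP: cF => /(_ u)/forallP.
apply/forallP => x; apply/forallP => y; rewrite -componentE.
have cC u : component F u = C.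
  by apply/eqP; rewrite -finset.in_set1 -CE imset_f.
by rewrite !cC.
Qed.

Lemma simple_graphS E F : F \subset E -> simple_graph E -> simple_graph F.
Proof.
move=> /fintype.subsetP FE /forall_inP sE; apply/forall_inP => e /FE; exact: sE.
Qed.

Lemma simple_graph_edge E e : simple_graph E -> e \in E ->
  exists x y, x != y /\ e = [set x; y]%SET.
Proof. by move=> /forall_inP sE /sE/cards2P[x [y [xy ->]]]; exists x, y. Qed.

Lemma leq_ncomp_card E : simple_graph E -> (#|T| <= ncomp E + #|E|)%N.
Proof.
have [n] := ubnP #|E|; elim: n E => // n IH E En sE.
have [->|[e eE]] := set_0Vmem E; first by rewrite ncomp0 leq_addr.
have [x [y [_ exy]]] := simple_graph_edge sE eE.
have sE' := simple_graphS (subD1set E e) sE.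
move: En; rewrite (cardsD1 e) eE => En; have := IH _ En sE'.
move/leq_trans; apply.
have -> : ncomp E =
  ncomp ([set x; y] |: (E :\ e))%SET by rewrite -exy finset.setD1K.
have [xy|/ncompU1 ->] := boolP (connect (adj (E :\ e)%SET) x y).
  by rewrite ncompU1_connect // leq_add2l leqnSn.
by rewrite addSn addnS.
Qed.

Lemma acyclicS E F : F \subset E -> acyclic E -> acyclic F.
Proof.
move=> /fintype.subsetP FE aE c /andP[cc uc]; apply: aE; rewrite /ucycle uc andbT.
by apply: sub_cycle cc => x y; apply: FE.
Qed.

(** In a forest no edge has its ends joined by the remaining edges, since such a path would close a
    cycle; so each edge lowers the component count by exactly one. *)
Lemma acyclic_ncomp E : simple_graph E -> acyclic E ->
  (ncomp E + #|E|)%N = #|T|.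
Proof.
have [n] := ubnP #|E|; elim: n E => // n IH E En sE aE.
have [->|[e eE]] := set_0Vmem E; first by rewrite ncomp0 cards0 addn0.
have [x [y [xy exy]]] := simple_graph_edge sE eE.
have sE' := simple_graphS (subD1set E e) sE.
have aE' := acyclicS (subD1set E e) aE.
move: En; rewrite (cardsD1 e) eE => En; rewrite -(IH _ En sE' aE').
suff : ~~ connect (adj (E :\ e)%SET) x y.
  by move/ncompU1 => ->; rewrite -exy finset.setD1K // addSn addnS.
apply/negP => /connectP[p pp yE].
case: (shortenP pp) yE => q qp uq _ yE.
have : ucycle (adj E) (x :: q).
  apply/andP; split=> //; rewrite /cycle rcons_path -yE.
  apply/andP; split; last by rewrite /adj /= finset.setUC -exy.
  by apply: sub_path qp => u v; rewrite /adj /= finset.in_setD1 => /andP[].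
move/aE; case: q yE qp {uq} => [yx|a [|//]] /=.
  by rewrite yx eqxx in xy.
by move=> <-; rewrite /adj /= -exy finset.in_setD1 eqxx.
Qed.

(** Deleting an edge of a cycle keeps the component count, so the remaining edges would be too few
    for [leq_ncomp_card]. *)
Lemma ncomp_acyclic E : simple_graph E ->
  (ncomp E + #|E|)%N = #|T| -> acyclic E.
Proof.
move=> sE nE [|x [|y [|z s]]] //= /andP[/=].
rewrite rcons_path /= => /and4P[xy yz zs sx].
rewrite !inE !negb_or => /and4P[/and3P[nxy nxz xs] /andP[nyz ys] nzs us].
have := leq_ncomp_card (simple_graphS (subD1set E [set x; y]%SET) sE).
have xyE : [set x; y]%SET \in E by [].
rewrite -nE (cardsD1 [set x; y]%SET E) xyE /=.
have -> : ncomp E =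
  ncomp ([set x; y] |: (E :\ [set x; y]))%SET by rewrite finset.setD1K.
rewrite ncompU1_connect ?addnS ?addSn ?addn0 ?ltnn // connect_adj_sym.
have xyN u v : u != x -> v != x -> ([set u; v] != [set x; y])%SET.
  move=> ux vx; apply/eqP => /setP/(_ x); rewrite !finset.inE eqxx.
  by rewrite ![x == _]eq_sym (negbTE ux) (negbTE vx).
have keep u v : u != x -> v != x -> adj E u v -> adj (E :\ [set x; y])%SET u v.
  by move=> ux vx uv; rewrite /adj /= finset.in_setD1 xyN.
(* The rest of the cycle leads from [y] to [x] without the edge xy: only its last step meets [x],
   and that step starts at [last z s], which is not [y]. *)
apply/connectP; exists (z :: rcons s x); last by rewrite /= last_rcons.
rewrite /= keep 1?eq_sym //= rcons_path; apply/andP; split.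
  have : all (predC1 x) (z :: s).
    by rewrite /= eq_sym nxz; apply/allP => w ws; apply: contraNneq xs => /= <-.
  elim: s z zs {sx xs ys nxz nyz nzs us yz} => //= w s IH z /andP[zw ws].
  by case/and3P => zx wx sx; rewrite keep //= IH //= wx.
have lsy : last z s \notin [:: x; y].
  have : last z s \in z :: s by apply: mem_last.
  rewrite !inE => /orP[/eqP->|ls]; first by rewrite ![z == _]eq_sym negb_or nxz.
  by rewrite negb_or; apply/andP; split; apply: contraTneq ls => ->.
rewrite /adj /= finset.in_setD1; apply/andP; split; last exact: sx.
apply/eqP => /setP/(_ (last z s)); rewrite finset.set21.
by move: lsy; rewrite finset.in_set2 !inE => /negbTE ->.
Qed.

(** The equation on [F] encodes that it is a forest. A maximal forest between [F] and [G] is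
    connected, because an edge of [G] between two of its components could still be added. *)
Lemma extend_tree F G : simple_graph G -> connected_graph G ->
    (0 < #|T|)%N -> F \subset G -> (ncomp F + #|F|)%N = #|T| ->
  exists E, [/\ is_tree E, F \subset E & E \subset G].
Proof.
move=> sG cG T0 FG nF.
pose P E := (E \subset G) && ((ncomp E + #|E|)%N == #|T|).
have [|E /maxsetP[/andP[EG /eqP nE] Emax] FE] := @maxset_exists _ P F.
  by rewrite /P FG nF eqxx.
have sE := simple_graphS EG sG.
exists E; split=> //; split=> //; last exact: ncomp_acyclic.
apply/forallP => x; apply/forallP => y.
have : connect (adj G) x y by move/forallP: cG => /(_ x)/forallP.
apply: connect_sub => u v uv; apply: contraT => nuv.
have uvE : [set u; v]%SET \notin E.
  by apply: contra nuv => uvE; exact: (@connect1 _ (adj E)).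
case/negP: uvE; rewrite -(Emax ([set u; v] |: E)%SET) ?setU11 ?finset.subsetUr //.
have uvG : [set u; v]%SET \in G := uv.
rewrite /P finset.subUset EG finset.sub1set uvG /= -nE (ncompU1 nuv) cardsU1.
case: (boolP ([set u; v]%SET \in E)) => [/(@connect1 _ (adj E) u v)|_].
  by rewrite (negbTE nuv).
by rewrite addSn addnS.
Qed.

Lemma tree_card E : (0 < #|T|)%N -> is_tree E -> #|T| = #|E|.+1.
Proof.
move=> T0 [sE cE aE]; rewrite -(acyclic_ncomp sE aE).
by move: cE; rewrite ncomp_connected // => /eqP ->; rewrite add1n.
Qed.

End Components.

(** * Long and short edges of minimal spanning trees *)

Section MinimalSpanningTreeCount.
Context {R : realType} (M : finMetricType R).
Implicit Types (E : {set {set M}}) (x y : M) (t : R).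

Definition light_edges E t : {set {set M}} :=
  [set e in E | edge_length e <= t]%SET.

Lemma light_edges_sub E t : light_edges E t \subset E.
Proof. by apply/fintype.subsetP => e; rewrite finset.inE => /andP[]. Qed.

Lemma card_light_edges E t :
  #|E| = (#|light_edges E t| + #|[set e in E | (t < edge_length e)%R]%SET|)%N.
Proof.
rewrite -(cardsID (light_edges E t) E) (finset.setIidPr (light_edges_sub E t)).
congr (_ + _)%N; apply: eq_card => e.
by rewrite !finset.inE; case: (e \in E); rewrite //= ?andbF ?andbT ?ltNge.
Qed.

(* Otherwise the edge xy could replace an edge of E longer than t. *)
Lemma mst_connect_light E t x y : is_mst E -> mdist x y <= t ->
  connect (adj (light_edges E t)) x y.
Proof.
move=> [tE Emin] xyt; set F := light_edges E t; apply: contraT => nxy.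
have M0 : (0 < #|M|)%N by apply/card_gt0P; exists x.
have [sE cE aE] := tE.
have FE : F \subset E by apply: light_edges_sub.
have nF := acyclic_ncomp (simple_graphS FE sE) (acyclicS FE aE).
have xyE : [set x; y]%SET \notin E.
  apply: contra nxy => xyE; apply: connect1.
  by rewrite /adj /= finset.inE xyE edge_length2.
have xNy : x != y by apply: contra nxy => /eqP ->; apply: connect0.
have sG : simple_graph ([set x; y] |: E)%SET.
  apply/forall_inP => e; rewrite finset.in_setU1 => /orP[/eqP ->|].
    by rewrite cards2 xNy.
  by move/forall_inP: sE; apply.
have cG : connected_graph ([set x; y] |: E)%SET.
  apply/forallP => u; apply/forallP => v.
  have : connect (adj E) u v by move/forallP: cE => /(_ u)/forallP.
  by apply: connect_adjS; apply: finset.subsetUr.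
have xyF : [set x; y]%SET \notin F.
  by apply: contra xyE; apply: (fintype.subsetP FE).
(* The tree [A] contains xy and every light edge. Both trees have the same number of edges, so [A]
   without xy misses exactly one edge [e] of [E], and [e] is longer than [t]; hence [A] is shorter
   than [E]. *)
have [||A [tA FA AG]] := @extend_tree _ ([set x; y] |: F)%SET _ sG cG M0.
- by apply: finset.setUS.
- by rewrite cardsU1 xyF addnA addn1 -ncompU1.
have xyA : [set x; y]%SET \in A by apply: (fintype.subsetP FA); rewrite setU11.
set B := (A :\ [set x; y])%SET.
have BE : B \subset E.
  apply/fintype.subsetP => e; rewrite finset.in_setD1 => /andP[exy /(fintype.subsetP AG)].
  by rewrite finset.in_setU1 (negbTE exy).
have : #|(E :\: B)%SET| == 1%N.
  rewrite cardsD (finset.setIidPr BE).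
  have := tree_card M0 tA; rewrite (tree_card M0 tE) => -[->].
  by rewrite (cardsD1 [set x; y]%SET A) xyA addnK.
case/cards1P => e EB.
have : e \in (E :\: B)%SET by rewrite EB set11.
rewrite finset.in_setD => /andP[eB eE].
have : t < edge_length e.
  rewrite ltNge; apply: contra eB => et.
  have eF : e \in F by rewrite finset.inE eE.
  rewrite finset.in_setD1; apply/andP; split.
    by apply: contraTneq eF => ->.
  by apply: (fintype.subsetP FA); rewrite finset.in_setU1 eF orbT.
have := Emin _ tA; rewrite /total_length (big_setID B) /=.
rewrite (finset.setIidPr BE) EB big_set1.
rewrite (big_setD1 _ xyA) /= edge_length2 addrC lerD2r leNgt => /negP + te.
by case; apply: le_lt_trans te.
Qed.

(** The light edges of [E] form a forest with one component more than [E] has longer edges. A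
    [t]-separated labelling is constant on these components, and points of different components are
    more than [t] apart. *)
Lemma mst_separated E t n : (0 < #|M|)%N -> is_mst E ->
  (exists2 f : M -> 'I_n.+1, (forall i, exists x, f x = i) &
     forall x y, f x != f y -> t < mdist x y) <->
  (n <= #|[set e in E | (t < edge_length e)%R]%SET|)%N.
Proof.
move=> M0 mE; have [[sE cE aE] _] := mE.
pose F := light_edges E t.
have sF := simple_graphS (light_edges_sub E t) sE.
have aF := acyclicS (light_edges_sub E t) aE.
have nF : ncomp F = #|[set e in E | (t < edge_length e)%R]%SET|.+1.
  have := acyclic_ncomp sF aF; rewrite (tree_card M0 mE.1).
  rewrite (card_light_edges E t) -addnS addnC => /eqP.
  by rewrite eqn_add2l => /eqP.
split.
  case=> f fsurj fsep; rewrite -ltnS -nF.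
  rewrite -[X in (X <= _)%N]card_ord.
  suff -> : #|'I_n.+1| = #|[set f u | u in M]%SET|.
    apply: leq_card_ncomp => u v; rewrite /adj /= finset.inE edge_length2.
    move=> /andP[_ uv]; apply/eqP; apply: contraT => /fsep.
    by rewrite ltNge uv.
  rewrite -cardsT; apply: eq_card => i; rewrite finset.in_setT.
  by apply/esym/imsetP; have [x <-] := fsurj i; exists x.
rewrite -ltnS -nF => nF'.
pose S := [set component F u | u in M]%SET.
have cS u : component F u \in enum S by rewrite mem_enum imset_f.
(* There may be more than [n.+1] components: they are numbered from 0, and those of index at least
   [n] are lumped into the class [n]. *)
exists (fun u => inord (minn n (index (component F u) (enum S)))).
  move=> i; have iS : (i < size (enum S))%N.
    by rewrite -cardE; apply: leq_trans nF'; apply: ltn_ord.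
  have : nth finset.set0 (enum S) i \in S by rewrite -mem_enum mem_nth.
  case/imsetP => x _ xE; exists x.
  rewrite -xE index_uniq ?enum_uniq //.
  have /minn_idPr -> : (i <= n)%N by rewrite -ltnS.
  exact: inord_val.
move=> x y; rewrite ltNge; apply: contra => xyt.
have /eqP -> // : component F x == component F y.
by rewrite componentE mst_connect_light.
Qed.

End MinimalSpanningTreeCount.

(** * Distance from a space to a simplex *)

Section SimplexDistance.
Context {R : realType}.
Implicit Types (X Y Z : metricType R) (r s t lam : R).

Lemma dGH_lt_close X Y r : (dGH X Y < r%:E)%E ->
  exists (Z : metricType R) (f : X -> Z) (g : Y -> Z),
    [/\ isometric f, isometric g,
        forall x, exists y, mdist (f x) (g y) < r &
        forall y, exists x, mdist (f x) (g y) < r].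
Proof.
case/ereal_inf_lt => _ [q [Z [f [g [fi gi H]]]] <-] qr.
move: H; rewrite /hausdorff_dist ge_max => /andP[/ereal_supP H1 /ereal_supP H2].
exists Z, f, g; split=> // [x|y].
  have /H1/le_lt_trans/(_ qr) :
      ([set ereal_inf [set (mdist a b)%:E | b in range g] | a in range f]
        (ereal_inf [set (mdist (f x) b)%:E | b in range g]))%classic.
    by exists (f x) => //; exists x.
  by case/ereal_inf_lt => _ [_ [y _ <-] <-]; rewrite lte_fin => ?; exists y.
have /H2/le_lt_trans/(_ qr) :
    ([set ereal_inf [set (mdist a b)%:E | a in range f] | b in range g]
      (ereal_inf [set (mdist a (g y))%:E | a in range f]))%classic.
  by exists (g y) => //; exists y.
by case/ereal_inf_lt => _ [_ [x _ <-] <-]; rewrite lte_fin => ?; exists x.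
Qed.

Lemma dGH_le_close X Y Z (f : X -> Z) (g : Y -> Z) r :
  isometric f -> isometric g ->
  (forall x, exists y, mdist (f x) (g y) <= r) ->
  (forall y, exists x, mdist (f x) (g y) <= r) -> (dGH X Y <= r%:E)%E.
Proof.
move=> fi gi fg gf; apply: ereal_inf_lbound; exists r => //.
exists Z, f, g; split=> //; rewrite /hausdorff_dist ge_max.
apply/andP; split; apply/ereal_supP => _ [_ [x _ <-] <-].
  have [y xy] := fg x; apply: le_trans (_ : ((mdist (f x) (g y))%:E <= _)%E);
    last by rewrite lee_fin.
  by apply: ereal_inf_lbound; exists (g y) => //; exists y.
have [y xy] := gf x; apply: le_trans (_ : ((mdist (f y) (g x))%:E <= _)%E);
    last by rewrite lee_fin.
by apply: ereal_inf_lbound; exists (f y) => //; exists y.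
Qed.

(** [simplex lam I] becomes a copy of [I] only once the test [0 < lam] is resolved; the bijection
    [h] spares later proofs any transport. *)
Lemma mdist_simplex lam (I : choiceType) : 0 < lam ->
  exists2 h : simplex lam I -> I, bijective h &
    forall i j, mdist i j = lam * (h i != h j)%:R.
Proof.
move=> lam0; rewrite (simplex_gt0 lam0); exists id; first by exists id.
by move=> i j; rewrite mdist_scaled mdist_Delta.
Qed.

(** Simplex and space are put side by side in [I + X], each point at distance [r] from its own label
    and [s] from all others. With [lam = r + s] and [t = s - r], the bound is [(lam - t) / 2]. *)
Lemma dGH_simplex_le X (I : choiceType) (f : X -> I) r s :
  0 < r -> r <= s -> (forall x y : X, mdist x y <= 2 * r) ->
  (forall i, exists x, f x = i) ->
  (forall x y, f x != f y -> s - r <= mdist x y) ->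
  (dGH (simplex (r + s) I) X <= r%:E)%E.
Proof.
move=> r0 rs Xr fsurj fsep.
have s0 : 0 < s by apply: lt_le_trans rs.
have [h [h' hK h'K] hd] := @mdist_simplex (r + s) I (addr_gt0 r0 s0).
pose e i x : R := if f x == i then r else s.
pose d (a b : I + X) : R := match a, b with
  | inl i, inl j => (r + s) * (i != j)%:R
  | inl i, inr x => e i x
  | inr x, inl i => e i x
  | inr x, inr y => mdist x y end.
have dxx a : d a a = 0 by case: a => a; rewrite /= ?eqxx ?mulr0 ?mdistxx.
have d0 a b : d a b = 0 -> a = b.
  case: a b => [i|x] [j|y] /=; rewrite /e.
  - by case: eqVneq => [->//|_ /eqP]; rewrite mulr1 gt_eqF // addr_gt0.
  - by case: ifP => _ /eqP; rewrite gt_eqF.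
  - by case: ifP => _ /eqP; rewrite gt_eqF.
  - by move/mdist_positivity ->.
have dC a b : d a b = d b a.
  by case: a b => [i|x] [j|y] //=; rewrite 1?eq_sym // metric_sym.
(* A vertex-point-vertex detour costs at least [r + s], as only one vertex is the label of the
   point. A point-vertex-point detour costs at least [2 * r]. The gap [s - r] serves the paths from
   a vertex [i] through a point labelled [i] to one labelled otherwise. *)
have dT b a c : d a c <= d a b + d b c.
  case: a b c => [i|x] [j|y] [k|z] /=; rewrite /e.
  - rewrite -mulrDr ler_pM2l ?addr_gt0 // -natrD ler_nat.
    by case: (eqVneq i j) => [->|_] //=; case: (i != k); rewrite ?leq_addr.
  - by have [->|_] := eqVneq i j; rewrite /= ?mulr0 ?mulr1; do ?case: ifP => _; lra.
  - case: (eqVneq i k) => [->|ik] /=; rewrite ?mulr0 ?mulr1.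
      by do ?case: ifP => _; lra.
    case: (eqVneq (f y) i) => [yi|_]; last by case: ifP => _; lra.
    by rewrite yi (negbTE ik); lra.
  - have yz := @mdist_ge0 _ _ y z.
    case: (eqVneq (f y) i) => [yi|_]; last by case: ifP => _; lra.
    case: eqVneq => [_|zi]; first by lra.
    by have := fsep y z; rewrite yi eq_sym => /(_ zi) ?; lra.
  - by have [->|_] := eqVneq j k; rewrite /= ?mulr0 ?mulr1; do ?case: ifP => _; lra.
  - have := Xr x z; by do ?case: ifP => _; lra.
  - have xy := @mdist_ge0 _ _ x y.
    case: (eqVneq (f y) k) => [yk|_]; last by case: ifP => _; lra.
    case: eqVneq => [_|xk]; first by lra.
    by have := fsep x y; rewrite yk => /(_ xk) ?; lra.
  - exact: metric_triangle.
pose Z : metricType R :=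
  HB.pack (I + X)%type (isMetric.Build R (I + X)%type dxx d0 dC dT).
apply: (@dGH_le_close _ _ Z (fun i => inl (h i)) inr).
- by move=> i j; rewrite hd.
- by [].
- by move=> i; have [x xi] := fsurj (h i); exists x; rewrite /mdist /= /e xi eqxx.
- by move=> x; exists (h' (f x)); rewrite /mdist /= /e h'K eqxx.
Qed.

(** Each point is labelled by a vertex closer than [r], so different labels force a gap above
    [(r + s) - 2 * r]. A point closer than [r] to the vertex [i] is labelled [i], since other
    vertices are [r + s >= 2 * r] away from [i]. The last clause serves the one-vertex simplex. *)
Lemma dGH_simplex_lt X (I : choiceType) r s :
  0 < r -> r <= s -> (dGH (simplex (r + s) I) X < r%:E)%E ->
  [/\ exists2 f : X -> I, (forall i, exists x, f x = i) &
        forall x y, f x != f y -> s - r < mdist x y &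
      (forall i j : I, i = j) -> forall x y : X, mdist x y < 2 * r].
Proof.
move=> r0 rs; have s0 : 0 < s by apply: lt_le_trans rs.
have [h [h' hK h'K] hd] := @mdist_simplex (r + s) I (addr_gt0 r0 s0).
case/dGH_lt_close => Z [g [k [gi ki gk kg]]]; split; last first.
  move=> I1 x y; have [i ix] := kg x; have [j jy] := kg y.
  have ij : i = j by apply: (can_inj hK).
  rewrite -ki; have := metric_triangle (k x) (g i) (k y).
  by move: ix jy; rewrite -ij [mdist (k x) (g _)]metric_sym; lra.
have [u uP] := choice kg.
exists (h \o u) => [i|x y /= uxy].
  have [x ix] := gk (h' i); exists x => /=; apply/eqP; apply: contraT => xi.
  have := metric_triangle (g (u x)) (k x) (g (h' i)); rewrite gi hd h'K xi mulr1.
  by move: ix (uP x); rewrite [mdist (k x) (g _)]metric_sym; lra.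
have := metric_triangle (g (u x)) (k x) (g (u y)); rewrite gi hd uxy mulr1.
have := metric_triangle (k x) (k y) (g (u y)); rewrite ki.
by move: (uP x) (uP y); rewrite [mdist (k y) (g _)]metric_sym; lra.
Qed.

End SimplexDistance.

(** * Invariants shared by indistinguishable spaces *)

Section Indistinguishable.
Context {R : realType}.

(** The witness is the largest distance; as a maximum over finitely many pairs it inherits strict
    bounds, which a supremum need not. *)
Lemma finMetric_bound (X : finMetricType R) :
  exists D : R, [/\ 0 <= D, forall x y : X, mdist x y <= D &
    forall a, 0 < a -> (forall x y : X, mdist x y < a) -> D < a].
Proof.
exists (\big[Order.max/0]_(p : X * X) mdist p.1 p.2); split.
- exact: bigmax_ge_id.
- by move=> x y; have := le_bigmax 0 (fun p : X * X => mdist p.1 p.2) (x, y).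
- by move=> a a0 Xa; apply: bigmax_lt.
Qed.

Lemma indistinguishable_separated (X Y : finMetricType R) (n : nat) (t : R) :
  indistinguishable X Y -> 0 <= t ->
  (exists2 f : X -> 'I_n.+1, (forall i, exists x, f x = i) &
     forall x y, f x != f y -> t < mdist x y) ->
  (exists2 f : Y -> 'I_n.+1, (forall i, exists x, f x = i) &
     forall x y, f x != f y -> t < mdist x y).
Proof.
move=> XY t0 [f fsurj fsep]; have [D [D0 XD _]] := finMetric_bound X.
(* Since X is finite, some t' > t still bounds the gaps between classes from
   below; this pays for the strict inequality on the side of Y. *)
pose t' := \big[Order.min/t + 1]_(p : X * X | f p.1 != f p.2) mdist p.1 p.2.
have tt' : t < t'.
  by apply: lt_bigmin => [|p /fsep //]; rewrite ltrDl.
have ft' x y : f x != f y -> t' <= mdist x y.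
  by move=> fxy; apply: (bigmin_le_cond _ _ (j := (x, y))).
(* [r] is positive and [2 * r] exceeds all distances of [X]. The side [2 * r + t'] is rewritten
   below as [2 * r2 + t]; since [r2 > r], the bound becomes strict for [Y] at the threshold [t]. *)
pose r := 1 + D; pose r2 := r + (t' - t) / 2.
have : (dGH (simplex (r + (r + t')) 'I_n.+1) X <= r%:E)%E.
  apply: (dGH_simplex_le (f := f)) => // [||x y|x y /ft'].
  - by rewrite /r; lra.
  - by lra.
  - by have := XD x y; rewrite /r; lra.
  - by lra.
rewrite XY; [|by exists ord0|by rewrite /r; lra].
have -> : r + (r + t') = r2 + (r2 + t) by rewrite /r2; lra.
move=> Yr; have : (dGH (simplex (r2 + (r2 + t)) 'I_n.+1) Y < r2%:E)%E.
  by apply: le_lt_trans Yr _; rewrite lte_fin /r2; lra.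
case/dGH_simplex_lt => [||[g gsurj gsep] _]; [by rewrite /r2 /r; lra|by lra|].
by exists g => // x y /gsep; rewrite addrAC subrr add0r.
Qed.

(** If a distance [a] of [Y] exceeded all those of [X], a one-vertex simplex would be closer than
    [a / 2] to [X], hence to [Y], forcing all distances of [Y] below [a]. *)
Lemma indistinguishable_diam_le (X Y : finMetricType R) :
  (0 < #|X|)%N -> indistinguishable X Y -> (diam Y <= diam X)%E.
Proof.
move=> /card_gt0P[x0 _] XY; apply/ereal_supP => _ [[y y'] _ <-] /=.
suff [x [x' xy]] : exists x x' : X, mdist y y' <= mdist x x'.
  apply: le_trans (_ : ((mdist x x')%:E <= _)%E); first by rewrite lee_fin.
  by apply: ereal_sup_ubound; exists (x, x').
apply: contrapT => nxx; set a := mdist y y' in nxx *.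
have Xa (x x' : X) : mdist x x' < a.
  by rewrite ltNge; apply/negP => ax; apply: nxx; exists x, x'.
have a0 : 0 < a by rewrite -(mdistxx x0).
have [D [D0 XD /(_ a a0 Xa) Da]] := finMetric_bound X.
(* [r] is midway between [D / 2] and [a / 2]. The side [r + a] is split anew below to apply the
   converse with radius [a / 2]. *)
pose r := (D + a) / 4.
have : (dGH (simplex (r + a) unit) X <= r%:E)%E.
  apply: (dGH_simplex_le (f := fun=> tt)) => // [||x x'|[]].
  - by rewrite /r; lra.
  - by rewrite /r; lra.
  - by have := XD x x'; rewrite /r; lra.
  - by exists x0.
rewrite XY; [|by exists tt|by rewrite /r; lra].
have -> : r + a = a / 2 + (r + a / 2) by lra.
move=> Yr; have : (dGH (simplex (a / 2 + (r + a / 2)) unit) Y < (a / 2)%:E)%E.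
  by apply: le_lt_trans Yr _; rewrite lte_fin /r; lra.
case/dGH_simplex_lt => [||_ /(_ _ y y') Ya]; [lra|by rewrite /r; lra|].
by have := Ya (fun i j => let: tt := i in let: tt := j in erefl); rewrite -/a; lra.
Qed.

Lemma mst_spectrumP (X : finMetricType R) : (0 < #|X|)%N ->
  exists2 E : {set {set X}}, is_mst E & mst_spectrum X = edge_lengths E.
Proof.
move=> X0; have [E0 mE0] := mst_exists X0; rewrite /mst_spectrum.
case: pickP => [E /asboolP mE|/(_ E0)]; first by exists E.
by move/asboolP.
Qed.

Lemma mst_spectrum_sorted (X : finMetricType R) : sorted >=%R (mst_spectrum X).
Proof. by apply: sort_sorted => x y; apply: le_total. Qed.

Lemma count_edge_lengths (X : finMetricType R) (E : {set {set X}}) (a : pred R) :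
  count a (edge_lengths E) = #|[set e in E | a (edge_length e)]%SET|.
Proof.
rewrite /edge_lengths (permP (permEl (perm_sort _ _))) count_map.
rewrite -sum1_count big_enum_cond -sum1_card.
by apply: eq_bigl => e; rewrite finset.inE.
Qed.

Lemma mst_spectrum_gt0 (X : finMetricType R) : (0 < #|X|)%N ->
  all (>%R^~ 0) (mst_spectrum X).
Proof.
move=> X0; have [E [[sE _ _] _] ->] := mst_spectrumP X0.
rewrite all_sort; apply/allP => _ /mapP[e + ->].
rewrite mem_enum => /(simple_graph_edge sE)[x [y [xy ->]]].
by rewrite edge_length2 /= mdist_gt0.
Qed.

Lemma size_mst_spectrum (X : finMetricType R) : (0 < #|X|)%N ->
  #|X| = (size (mst_spectrum X)).+1.
Proof.
move=> X0; have [E [tE _] ->] := mst_spectrumP X0.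
by rewrite size_sort size_map -cardE (tree_card X0 tE).
Qed.

(** If the heads differed, the smaller one taken as threshold would count nothing in its own list
    but at least the head of the other. Equal heads cancel in all counts. As entries are positive,
    the threshold 0 tells an empty list from a non-empty one. *)
Lemma eq_sorted_count_gt (s1 s2 : seq R) :
  sorted >=%R s1 -> sorted >=%R s2 ->
  all (>%R^~ 0) s1 -> all (>%R^~ 0) s2 ->
  (forall t, 0 <= t -> count (>%R^~ t) s1 = count (>%R^~ t) s2) -> s1 = s2.
Proof.
have ge_trans : transitive (>=%R : rel R) by move=> y x z xy /le_trans; apply.
have head_le (a b : R) r1 r2 : sorted >=%R (a :: r1) -> 0 < b ->
    (forall t, 0 <= t -> count (>%R^~ t) (a :: r1) = count (>%R^~ t) (b :: r2)) ->
    0 <= a -> b <= a.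
  move=> /= pa b0 cE a0; rewrite leNgt; apply/negP => ab.
  have := cE _ a0; rewrite /= ab ltxx add0n (_ : count _ r1 = 0%N) //.
  apply/eqP; rewrite -leqn0 leqNgt -has_count -all_predC.
  apply: sub_all (order_path_min ge_trans pa) => x /=.
  by rewrite -leNgt.
elim: s1 s2 => [|a s1 IH] [|b s2] //=.
- by move=> _ _ _ /andP[b0 _] /(_ _ (lexx 0)); rewrite b0.
- by move=> _ _ /andP[a0 _] _ /(_ _ (lexx 0)); rewrite a0.
move=> p1 p2 /andP[a0 s10] /andP[b0 s20] cE.
have ab : a = b.
  apply/le_anti/andP; split.
    by apply: (head_le b a s2 s1) => // [t /cE|]; rewrite // ltW.
  by apply: (head_le a b s1 s2) => //; rewrite ltW.
subst b; congr (_ :: _); apply: IH => //;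
  [exact: path_sorted p1|exact: path_sorted p2|].
by move=> t /cE /eqP; rewrite eqn_add2l => /eqP.
Qed.

Lemma indistinguishable_count_le (X Y : finMetricType R) (t : R) :
  (0 < #|X|)%N -> (0 < #|Y|)%N -> indistinguishable X Y -> 0 <= t ->
  (count (>%R^~ t) (mst_spectrum X) <= count (>%R^~ t) (mst_spectrum Y))%N.
Proof.
move=> X0 Y0 XY t0.
have [E mE ->] := mst_spectrumP X0; have [F mF ->] := mst_spectrumP Y0.
rewrite !count_edge_lengths; apply/(mst_separated _ _ Y0 mF).
by apply: indistinguishable_separated XY t0 _; apply/(mst_separated _ _ X0 mE).
Qed.

Lemma indistinguishable_sym (X Y : metricType R) :
  indistinguishable X Y -> indistinguishable Y X.
Proof. by move=> XY n n0 lam lam0; rewrite XY. Qed.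

End Indistinguishable.

Theorem corollary5p3 (R : realType) (X Y : finMetricType R)
    (X_nonempty : (0 < #|X|)%N) (Y_nonempty : (0 < #|Y|)%N)
    (XY : indistinguishable X Y) :
  [/\ #|X| = #|Y|, diam X = diam Y & mst_spectrum X = mst_spectrum Y].
Proof.
have YX := indistinguishable_sym XY.
have sXY : mst_spectrum X = mst_spectrum Y.
  apply: eq_sorted_count_gt; rewrite ?mst_spectrum_sorted ?mst_spectrum_gt0 //.
  by move=> t t0; apply/eqP; rewrite eqn_leq !indistinguishable_count_le.
split; last exact: sXY.
  (* The cardinality comes from the spectrum, which has one entry fewer than there are points. *)
  by rewrite (size_mst_spectrum X_nonempty) sXY -size_mst_spectrum.
by apply/le_anti; rewrite !indistinguishable_diam_le.
Qed.
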